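(* For all $n\ge1$, $$a_{\{0101,0112\}}(n)=a_{\{0102,0112\}}(n)=a_{\{0121,0112\}}(n)=a_{\{0102,0120\}}(n)=(n-1)2^{n-2}+1.$$
   Context: An ascent in an integer sequence $s_1\cdots s_m$ is an index $j$ with $s_j<s_{j+1}$; $\mathrm{asc}$ denotes the number of ascents. An ascent sequence is a sequence $x_1\cdots x_n$ of nonnegative integers with $x_1=0$ and $x_i\le 1+\mathrm{asc}(x_1\cdots x_{i-1})$ for all $i\ge2$. The reduction $\mathrm{red}(w)$ of an integer sequence $w$ replaces the $i$-th smallest distinct letter of $w$ by $i-1$; a pattern is a reduced sequence. A sequence $x$ contains a pattern $p=p_1\cdots p_k$ if there are indices $i_1<\cdots<i_k$ with $\mathrm{red}(x_{i_1}\cdots x_{i_k})=p$; otherwise $x$ avoids $p$. For a finite set $P$ of patterns, $a_P(n)$ denotes the number of ascent sequences of length $n$ avoiding every pattern in $P$. *)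

(* Defs.v *)
From mathcomp Require Import all_boot.
Set Implicit Arguments. Unset Strict Implicit. Unset Printing Implicit Defensive.

Fixpoint asc (s : seq nat) : nat :=
  match s with
  | x :: ((y :: _) as t) => (x < y) + asc t
  | _ => 0
  end.

Definition is_ascent_seq (x : seq nat) : bool :=
  (head 1 x == 0) &&
  [forall i : 'I_(size x), (0 < i) ==> (nth 0 x i <= (asc (take i x)).+1)].

Definition red (w : seq nat) : seq nat :=
  map (fun a => index a (sort leq (undup w))) w.

Definition contains (x p : seq nat) : bool :=
  [exists m : (size x).-tuple bool, red (mask m x) == p].

Definition avoids_all (P : seq (seq nat)) (x : seq nat) : bool :=
  all (fun p => ~~ contains x p) P.

(* a_P(n): ascent sequences of length n avoiding all patterns of P.
   Every ascent sequence of length n has entries <= n-1, so enumerating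
   n-tuples over 'I_n loses nothing. *)
Definition aP (P : seq (seq nat)) (n : nat) : nat :=
  #|[set t : n.-tuple 'I_n |
      is_ascent_seq (map val t) && avoids_all P (map val t)]|.

(* Main.v *)
Require Import Defs.
From mathcomp Require Import all_boot zify.
Set Implicit Arguments. Unset Strict Implicit. Unset Printing Implicit Defensive.

(** Grow ascent sequences letter by letter at the right end. For each of the
four pattern pairs, the admissible continuations of a prefix depend only on a
state. In a "free" state the values 0, ..., k have been met, each in its turn,
and the prefix has exactly k ascents, so k+1 is still admissible. The first
repetition (or descent) that forbids every new maximum leads to a "tail" state,
in which the admissible letters are a fixed explicit set shrinking from step to
step. The number of extensions by n letters then obeys a recurrence in the
parameters of the state, solved by powers of 2 or by sums of binomial
coefficients; starting from the prefix 0, all four pairs give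
n 2^(n-1) + 1 extensions by n letters. *)

(** * Subsequences and ascent sequences under appending a letter *)

Lemma subseq_rcons_rcons (T : eqType) (s x : seq T) (b a : T) :
  subseq (rcons s b) (rcons x a) =
  subseq (rcons s b) x || (b == a) && subseq s x.
Proof.
rewrite -subseq_rev !rev_rcons -(subseq_rev (rcons s b)) rev_rcons.
rewrite -(subseq_rev s x) /=.
have [_|_] := eqVneq b a; rewrite ?orbF //=.
apply/idP/orP => [|[h|//]]; first by right.
by apply: subseq_trans h; apply: subseq_cons.
Qed.

Lemma subseq_rconsW (T : eqType) (s x : seq T) (a : T) :
  subseq s x -> subseq s (rcons x a).
Proof. by move=> h; apply: subseq_trans h (subseq_rcons _ _). Qed.

(** Filtering [iota 0 n] by membership in [s] gives a strictly increasing list with the members of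
    [s], hence [s] itself. *)
Lemma sorted_subseq_iota (s : seq nat) n :
  sorted ltn s -> all (gtn n) s -> subseq s (iota 0 n).
Proof.
move=> ss /allP hs; suff -> : s = filter [in s] (iota 0 n) by apply: filter_subseq.
apply: (irr_sorted_eq ltn_trans ltnn) => //.
  exact: sorted_filter ltn_trans _ _ (iota_ltn_sorted _ _).
move=> i; rewrite mem_filter mem_iota add0n /=.
by case: (boolP (i \in s)) => // /hs /= ->.
Qed.

Lemma asc_rcons (x : seq nat) (a : nat) :
  x != [::] -> asc (rcons x a) = asc x + (last 0 x < a).
Proof.
case: x => // b x _; elim: x b => [|c x IH] b; first by rewrite /= addn0 add0n.
by have /= -> := IH c; rewrite addnA.
Qed.

Lemma asc_leq x : asc x <= (size x).-1.
Proof. elim: x => //= b [|c x] //= IH; lia. Qed.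

Lemma is_ascent_seqP x :
  reflect (head 1 x = 0 /\
           forall i, 0 < i < size x -> nth 0 x i <= (asc (take i x)).+1)
          (is_ascent_seq x).
Proof.
apply: (iffP andP) => [[/eqP h /forallP H]|[-> H]]; split=> //.
  move=> i /andP[i0 ix]; exact: (implyP (H (Ordinal ix))) i0.
by apply/forallP => i; apply/implyP => i0; apply: H; rewrite i0 ltn_ord.
Qed.

Lemma is_ascent_seq_rcons (x : seq nat) (a : nat) : x != [::] ->
  is_ascent_seq (rcons x a) = is_ascent_seq x && (a <= (asc x).+1).
Proof.
move=> nx; have hd : head 1 (rcons x a) = head 1 x by case: x nx.
have sx : 0 < size x by case: x nx hd.
apply/is_ascent_seqP/andP; rewrite hd size_rcons.
  case=> h0 H; split.
    apply/is_ascent_seqP; split=> // i /andP[i0 ix].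
    have ii : 0 < i < (size x).+1 by lia.
    by have := H i ii; rewrite nth_rcons ix -cats1 takel_cat // ltnW.
  have ii : 0 < size x < (size x).+1 by lia.
  by have := H _ ii; rewrite nth_rcons ltnn eqxx -cats1 take_size_cat.
case=> /is_ascent_seqP[h0 H] ha; split=> // i /andP[i0].
rewrite ltnS leq_eqVlt => /orP[/eqP ->|ix].
  by rewrite nth_rcons ltnn eqxx -cats1 take_size_cat.
have ii : 0 < i < size x by lia.
by rewrite nth_rcons ix -cats1 takel_cat ?(ltnW ix) //; apply: H.
Qed.

(** A prefix of length i > 0 has at most i-1 ascents, so the next letter is at most i. *)
Lemma ascent_seq_ltn x : is_ascent_seq x -> all (gtn (size x)) x.
Proof.
move=> /is_ascent_seqP[h0 H]; apply/(all_nthP 0) => i ix /=.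
case: i ix => [|i] ix; first by rewrite nth0; case: x h0 {H} ix => //= b x ->.
apply: leq_ltn_trans (H _ _) _; rewrite ?ix //.
have := asc_leq (take i.+1 x); rewrite size_takel ?(ltnW ix) //=; lia.
Qed.

(** * Pattern containment through subsequences *)

(* A reduced pattern p on k letters occurs in x exactly when some increasing
   t_0 < ... < t_(k-1) makes t_(p_1) ... t_(p_m) a subsequence of x. *)
Lemma containsP (x p : seq nat) (k : nat) : p =i iota 0 k ->
  reflect (exists t, [/\ size t = k, sorted ltn t &
                         subseq [seq nth 0 t i | i <- p] x])
          (contains x p).
Proof.
move=> pk; apply: (iffP existsP).
  case=> m /eqP; set w := mask m x => wp.
  pose t := sort leq (undup w).
  have tw : t =i w by move=> i; rewrite mem_sort mem_undup.
  have st : sorted ltn t.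
    by rewrite ltn_sorted_uniq_leq sort_uniq undup_uniq sort_sorted //; apply: leq_total.
  have ut : uniq t by move: st; rewrite ltn_sorted_uniq_leq => /andP[].
  exists t; split=> //.
    (* The letters of [red w] are exactly the positions in [t]; those of [p] are 0, ..., k-1. *)
    have: perm_eq (iota 0 (size t)) (iota 0 k).
      apply: uniq_perm; rewrite ?iota_uniq // => i; rewrite -pk -wp mem_iota add0n /=.
      apply/idP/mapP => [it|[j jw ->]]; last by rewrite index_mem tw.
      by exists (nth 0 t i); rewrite -?tw ?mem_nth // index_uniq.
    by move/perm_size; rewrite !size_iota.
  suff -> : [seq nth 0 t i | i <- p] = w by apply: mask_subseq.
  rewrite -wp /red -map_comp -[RHS]map_id; apply/eq_in_map => i iw /=.
  by rewrite nth_index // tw.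
case=> t [tk st /subseqP[m sm em]].
have [ut sl] : uniq t /\ sorted leq t by apply/andP; rewrite -ltn_sorted_uniq_leq.
exists (tcast sm (in_tuple m)); rewrite val_tcast /= -em /red.
(* As [p] uses every letter below k, each entry of [t] occurs in [w], so sorting the distinct
   letters of [w] gives back [t]. *)
set w := map _ p; have tE : sort leq (undup w) = t.
  apply: (irr_sorted_eq ltn_trans ltnn) => //.
    by rewrite ltn_sorted_uniq_leq sort_uniq undup_uniq sort_sorted //; apply: leq_total.
  move=> i; rewrite mem_sort mem_undup; apply/mapP/idP => [[j jp ->]|it].
    by rewrite mem_nth // tk; move: jp; rewrite pk mem_iota.
  by exists (index i t); rewrite ?nth_index // pk mem_iota -tk index_mem.
rewrite tE /w -map_comp; apply/eqP; rewrite -[RHS]map_id; apply/eq_in_map => i.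
by rewrite pk mem_iota add0n -tk /= => it; rewrite index_uniq.
Qed.

(** A new occurrence must end at the appended [a], which then plays the last pattern letter [j]. *)
Lemma contains_rcons (x : seq nat) (a : nat) (p : seq nat) (j k : nat) : rcons p j =i iota 0 k.+1 ->
  contains (rcons x a) (rcons p j) <->
  contains x (rcons p j) \/
  exists t, [/\ size t = k.+1, sorted ltn t,
                nth 0 t j = a & subseq [seq nth 0 t i | i <- p] x].
Proof.
move=> pk; split.
  case/(containsP _ pk) => t [tk st]; rewrite map_rcons subseq_rcons_rcons.
  case/orP=> [h|/andP[/eqP ta h]]; [left|by right; exists t].
  by apply/(containsP _ pk); exists t; rewrite map_rcons.
case=> [/(containsP _ pk)|] [t]; last first.
  case=> tk st ta h; apply/(containsP _ pk); exists t; split=> //.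
  by rewrite map_rcons subseq_rcons_rcons ta eqxx h orbT.
case=> tk st h; apply/(containsP _ pk); exists t; split=> //.
exact: subseq_rconsW.
Qed.

(** * Growing good sequences letter by letter *)

Definition good P (x : seq nat) := is_ascent_seq x && avoids_all P x.

Lemma good_neq0 P (x : seq nat) : good P x -> x != [::].
Proof. by case: x => //; rewrite /good /is_ascent_seq. Qed.

Lemma contains_rconsW (x : seq nat) (a : nat) (p : seq nat) : contains x p -> contains (rcons x a) p.
Proof.
case/existsP => m hm; have sz : size (rcons m false) = size (rcons x a).
  by rewrite !size_rcons size_tuple.
apply/existsP; exists (tcast sz (in_tuple (rcons m false))).
by rewrite val_tcast /= -!cats1 mask_cat ?size_tuple //= cats0.
Qed.

Lemma good_rconsW P (x : seq nat) (a : nat) : x != [::] -> good P (rcons x a) -> good P x.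
Proof.
move=> nx /andP[]; rewrite is_ascent_seq_rcons // => /andP[h _] /allP H.
rewrite /good h; apply/allP => p /H; apply: contra; exact: contains_rconsW.
Qed.

(** Letters are removed from the right one at a time. Hence growing only good prefixes loses no good
    sequence. *)
Lemma good_catl P (x z : seq nat) : x != [::] -> good P (x ++ z) -> good P x.
Proof.
move=> nx; elim/last_ind: z => [|z a IH]; first by rewrite cats0.
by rewrite -rcons_cat => /good_rconsW h; apply: IH; apply: h; case: x nx.
Qed.

(** The candidates stop at [asc x + 1], the largest letter that the ascent condition allows. *)
Fixpoint ext P n (x : seq nat) : seq (seq nat) :=
  if n is n'.+1 then
    [seq y | a <- [seq a <- iota 0 (asc x).+2 | good P (rcons x a)],
             y <- ext P n' (rcons x a)]
  else [:: x].

Lemma mem_ext P n (x y : seq nat) : good P x ->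
  reflect (exists z, [/\ size z = n, y = x ++ z & good P y]) (y \in ext P n x).
Proof.
elim: n x y => [|n IH] x y gx.
  rewrite inE; apply: (iffP eqP) => [->|[z [/size0nil ->]]]; last by rewrite cats0.
  by exists [::]; rewrite cats0.
have nx := good_neq0 gx.
apply: (iffP allpairsPdep) => [[a [w [+ + ->]]]|].
  rewrite mem_filter => /andP[ga _] /(IH _ _ ga)[z [sz -> gy]].
  by exists (a :: z); rewrite /= sz -cat_rcons.
case=> -[|a z] [] // [sz]; rewrite -cat_rcons => -> gy.
have ga : good P (rcons x a).
  by apply: good_catl gy; case: (x).
exists a, (rcons x a ++ z); split=> //; last by apply/(IH _ _ ga); exists z.
rewrite mem_filter ga mem_iota ltnS.
by move: ga; rewrite /good is_ascent_seq_rcons // => /andP[/andP[_]].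
Qed.

Lemma ext_uniq P n (x : seq nat) : good P x -> uniq (ext P n x).
Proof.
elim: n x => // n IH x gx; apply: allpairs_uniq_dep.
- by rewrite filter_uniq ?iota_uniq.
- by move=> a; rewrite mem_filter => /andP[/IH].
move=> u v /allpairsPdep[a [y [+ + ->]]] /allpairsPdep[b [w [+ + ->]]] /=.
rewrite !mem_filter => /andP[ga _] /(mem_ext _ _ ga)[z1 [_ e1 _]].
move=> /andP[gb _] /(mem_ext _ _ gb)[z2 [_ e2 _]] ey.
(* The letter at position [size x] of a common extension determines the first appended letter. *)
suff eab : a = b by rewrite eab ey.
move: ey; rewrite e1 e2 => /(congr1 (fun s => nth 0 s (size x))).
by rewrite !nth_cat !size_rcons !ltnSn !nth_rcons !ltnn !eqxx.
Qed.

(** Turns a description of the admissible next letters into a recurrence for the number of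
    extensions. *)
Lemma size_extS P n (x s : seq nat) : good P x -> uniq s ->
  (forall a, good P (rcons x a) <-> a \in s) ->
  size (ext P n.+1 x) = \sum_(a <- s) size (ext P n (rcons x a)).
Proof.
move=> gx us hs; rewrite size_allpairs_dep sumnE big_map; apply: perm_big.
apply: uniq_perm; rewrite ?filter_uniq ?iota_uniq // => a.
rewrite mem_filter mem_iota /=; apply/andP/idP => [[/hs]//|/hs ga]; split=> //.
by move: ga; rewrite /good is_ascent_seq_rcons ?(good_neq0 gx) // => /andP[/andP[_]].
Qed.

(** Every ascent sequence starts with 0, and forgetting the bound on the letters is injective on
    tuples. *)
Lemma aP_ext P n : good P [:: 0] -> aP P n.+1 = size (ext P n [:: 0]).
Proof.
move=> g0; rewrite /aP; set A := finset _; pose f (t : n.+1.-tuple 'I_n.+1) : seq nat := map val t.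
have finj : injective f.
  by move=> t u e; apply: val_inj; apply: (inj_map val_inj) e.
suff : perm_eq [seq f t | t <- enum A] (ext P n [:: 0]).
  by move/perm_size; rewrite size_map -cardE.
apply: uniq_perm; rewrite ?ext_uniq ?map_inj_uniq ?enum_uniq // => y.
apply/mapP/(mem_ext _ _ g0) => [[t]|[z [sz -> gy]]].
  rewrite mem_enum inE => gt ->.
  have gf : good P (f t) by [].
  have : size (f t) = n.+1 by rewrite size_map size_tuple.
  case: (f t) gf => // b z gf [sz]; exists z; split=> //=.
  by case/andP: gf => /is_ascent_seqP[/= -> _].
(* All letters are below the length, so [inord] rebuilds a tuple without altering them. *)
have al : all (gtn n.+1) (0 :: z).
  by case/andP: gy => /ascent_seq_ltn; rewrite /= sz.
have sy : size (map (fun i => inord i : 'I_n.+1) (0 :: z)) == n.+1.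
  by rewrite size_map /= sz.
have e : f (Tuple sy) = 0 :: z.
  rewrite -[LHS]/(map val (map _ (0 :: z))) -map_comp -[RHS]map_id.
  apply/eq_in_map => i iz /=.
  by rewrite inordK //; move/allP: al; apply.
by exists (Tuple sy); rewrite // mem_enum inE [map val _]e.
Qed.

(** * Patterns completed by the last letter *)

(** [p] is the pattern stripped of its last letter [j], [k] is the number of distinct letters of the
    full pattern, and [t] lists their values. *)
Definition completes (p : seq nat) (j k : nat) (x : seq nat) (a : nat) : Prop :=
  exists t, [/\ size t = k, sorted ltn t, nth 0 t j = a &
                subseq [seq nth 0 t i | i <- p] x].

(** A good prefix contains neither pattern, so only occurrences ending in [a] can do harm; [A] and
    [B] are explicit forms of their absence. *)
Lemma good_rcons2 (p q : seq nat) (i j k l : nat) (x : seq nat) (a : nat)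
    (A B : Prop) :
  (~ completes p i k.+1 x a <-> A) -> (~ completes q j l.+1 x a <-> B) ->
  rcons p i =i iota 0 k.+1 -> rcons q j =i iota 0 l.+1 ->
  good [:: rcons p i; rcons q j] x ->
  good [:: rcons p i; rcons q j] (rcons x a) <->
  [/\ a <= (asc x).+1, A & B].
Proof.
move=> hA hB pk ql gx; have nx := good_neq0 gx; move: gx.
rewrite /good is_ascent_seq_rcons // /avoids_all /= !andbT.
move=> /andP[-> /andP[npx nqx]] /=; split.
  case/andP=> -> /andP[/negP np /negP nq]; split=> //; [apply/hA|apply/hB] => h; [apply: np|apply: nq].
    by apply/(contains_rcons _ _ pk); right.
  by apply/(contains_rcons _ _ ql); right.
case=> -> /hA np /hB nq /=; apply/andP; split; apply/negP.
  by move=> /(contains_rcons _ _ pk)[h|//]; move: npx; rewrite h.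
by move=> /(contains_rcons _ _ ql)[h|//]; move: nqx; rewrite h.
Qed.

(* avXXXX x a: appending a to x creates no occurrence of the pattern XXXX
   ending in that last letter. *)
Definition av0101 (x : seq nat) a := forall c, c < a -> ~~ subseq [:: c; a; c] x.
Definition av0112 (x : seq nat) a :=
  forall c b, c < b < a -> ~~ subseq [:: c; b; b] x.
Definition av0102 (x : seq nat) a :=
  forall c b, c < b < a -> ~~ subseq [:: c; b; c] x.
Definition av0121 (x : seq nat) a :=
  forall c b, c < a < b -> ~~ subseq [:: c; a; b] x.
Definition av0120 (x : seq nat) a :=
  forall b c, a < b < c -> ~~ subseq [:: a; b; c] x.

Lemma completes0101 x a : ~ completes [:: 0; 1; 0] 1 2 x a <-> av0101 x a.
Proof.
split=> [h c ca|h [[|c [|b [|? ?]]] []] //= _ /andP[cb _] ba].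
  by apply/negP => s; apply: h; exists [:: c; a]; rewrite /= ca.
by apply/negP; rewrite ba; apply: h; rewrite -ba.
Qed.

Lemma completes0112 x a : ~ completes [:: 0; 1; 1] 2 3 x a <-> av0112 x a.
Proof.
split=> [h c b cba|h [[|c [|b [|d [|? ?]]]] []] //= _ /and3P[cb bd _] ba].
  apply/negP => s; apply: h; exists [:: c; b; a]; split=> //=; lia.
by apply/negP; apply: h; rewrite -ba cb.
Qed.

Lemma completes0102 x a : ~ completes [:: 0; 1; 0] 2 3 x a <-> av0102 x a.
Proof.
split=> [h c b cba|h [[|c [|b [|d [|? ?]]]] []] //= _ /and3P[cb bd _] ba].
  apply/negP => s; apply: h; exists [:: c; b; a]; split=> //=; lia.
by apply/negP; apply: h; rewrite -ba cb.
Qed.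

Lemma completes0121 x a : ~ completes [:: 0; 1; 2] 1 3 x a <-> av0121 x a.
Proof.
split=> [h c b cba|h [[|c [|b [|d [|? ?]]]] []] //= _ /and3P[cb bd _] ba].
  apply/negP => s; apply: h; exists [:: c; a; b]; split=> //=; lia.
by apply/negP; rewrite ba; apply: h; rewrite -ba cb.
Qed.

Lemma completes0120 x a : ~ completes [:: 0; 1; 2] 0 3 x a <-> av0120 x a.
Proof.
split=> [h c b cba|h [[|c [|b [|d [|? ?]]]] []] //= _ /and3P[cb bd _] ba].
  apply/negP => s; apply: h; exists [:: a; c; b]; split=> //=; lia.
by apply/negP; rewrite ba; apply: h; rewrite -ba cb.
Qed.

Definition P1 := [:: [:: 0; 1; 0; 1]; [:: 0; 1; 1; 2]].
Definition P2 := [:: [:: 0; 1; 0; 2]; [:: 0; 1; 1; 2]].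
Definition P3 := [:: [:: 0; 1; 2; 1]; [:: 0; 1; 1; 2]].
Definition P4 := [:: [:: 0; 1; 0; 2]; [:: 0; 1; 2; 0]].

Lemma good_P1 x a : good P1 x ->
  good P1 (rcons x a) <-> [/\ a <= (asc x).+1, av0101 x a & av0112 x a].
Proof.
move=> gx.
by apply: (@good_rcons2 [:: 0; 1; 0] [:: 0; 1; 1] 1 2 1 2 _ _ _ _ (completes0101 _ _) (completes0112 _ _)) => // i;
  rewrite /= !inE; lia.
Qed.

Lemma good_P2 x a : good P2 x ->
  good P2 (rcons x a) <-> [/\ a <= (asc x).+1, av0102 x a & av0112 x a].
Proof.
move=> gx.
by apply: (@good_rcons2 [:: 0; 1; 0] [:: 0; 1; 1] 2 2 2 2 _ _ _ _ (completes0102 _ _) (completes0112 _ _)) => // i;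
  rewrite /= !inE; lia.
Qed.

Lemma good_P3 x a : good P3 x ->
  good P3 (rcons x a) <-> [/\ a <= (asc x).+1, av0121 x a & av0112 x a].
Proof.
move=> gx.
by apply: (@good_rcons2 [:: 0; 1; 2] [:: 0; 1; 1] 1 2 2 2 _ _ _ _ (completes0121 _ _) (completes0112 _ _)) => // i;
  rewrite /= !inE; lia.
Qed.

Lemma good_P4 x a : good P4 x ->
  good P4 (rcons x a) <-> [/\ a <= (asc x).+1, av0102 x a & av0120 x a].
Proof.
move=> gx.
by apply: (@good_rcons2 [:: 0; 1; 0] [:: 0; 1; 2] 2 0 2 2 _ _ _ _ (completes0102 _ _) (completes0120 _ _)) => // i;
  rewrite /= !inE; lia.
Qed.

Lemma good_seq1 P : all (fun p => 1 < size p) P -> good P [:: 0].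
Proof.
move=> /allP hP; apply/andP; split.
  by apply/is_ascent_seqP; split=> // -[].
apply/allP => p /hP sp; apply/negP => /existsP[m /eqP e].
move: sp; rewrite -e size_map; have := size_subseq (mask_subseq m [:: 0]).
by rewrite leqNgt => /negbTE ->.
Qed.

(** * Persistence of avoidance, upper bounds and chains *)

Lemma subseq_rcons3 (x : seq nat) (a p q r : nat) :
  subseq [:: p; q; r] (rcons x a) =
  subseq [:: p; q; r] x || (r == a) && subseq [:: p; q] x.
Proof. exact: (subseq_rcons_rcons [:: p; q] x r a). Qed.

(** Here and in the next two lemmas a new forbidden triple ends in the appended [a], so only pairs
    of [x] that [a] completes need checking. *)
Lemma av0112_rcons x a K : av0112 x K ->
  (forall c, c < a < K -> ~~ subseq [:: c; a] x) -> av0112 (rcons x a) K.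
Proof.
move=> h ha c b cb; rewrite subseq_rcons3 negb_or h //=.
by case: eqVneq cb => // -> /ha.
Qed.

Lemma av0102_rcons x a K : av0102 x K ->
  (forall b, a < b < K -> ~~ subseq [:: a; b] x) -> av0102 (rcons x a) K.
Proof.
move=> h ha c b cb; rewrite subseq_rcons3 negb_or h //=.
by case: eqVneq cb => // -> /ha.
Qed.

Lemma av0101_rcons x a b : av0101 x b ->
  (a < b -> ~~ subseq [:: a; b] x) -> av0101 (rcons x a) b.
Proof.
move=> h ha c cb; rewrite subseq_rcons3 negb_or h //=.
by case: eqVneq cb => // -> /ha.
Qed.

Definition below k (x : seq nat) := forall y, y \in x -> y <= k.

Lemma below_rcons k x a : below k x -> a <= k -> below k (rcons x a).
Proof. by move=> h ak y; rewrite mem_rcons inE => /orP[/eqP ->|/h]. Qed.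

Lemma belowW k l x : below k x -> k <= l -> below l x.
Proof. by move=> h kl y /h yk; apply: leq_trans kl. Qed.

(** Rules out occurrences that would need a letter not yet reached. *)
Lemma below_notin k x s a : below k x -> a \in s -> k < a -> ~~ subseq s x.
Proof. by move=> h sa ka; apply/negP => /mem_subseq/(_ _ sa)/h; lia. Qed.

Lemma below_last k x : below k x -> last 0 x <= k.
Proof. by case: x => // b x h; apply: (h _ (mem_last b x)). Qed.

Lemma chain_rconsS k x :
  subseq (iota 0 k.+1) x -> subseq (iota 0 k.+2) (rcons x k.+1).
Proof.
move=> h; rewrite -[k.+2]addn1 iotaD cats1 subseq_rcons_rcons.
by rewrite add0n eqxx h orbT.
Qed.

(** Supplies the occurrences that forbid letters: once 0, ..., k have appeared in order, every
    increasing choice among them is available. *)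
Lemma chain_subseq k x s : subseq (iota 0 k.+1) x ->
  sorted ltn s -> all (leq^~ k) s -> subseq s x.
Proof. by move=> h ss sk; apply: subseq_trans h; apply: sorted_subseq_iota. Qed.

Lemma asc_rcons_geq x a : asc x <= asc (rcons x a).
Proof. by case: x => // b x; rewrite asc_rcons // leq_addr. Qed.

Lemma below_seq1 : below 0 [:: 0].
Proof. by move=> y; rewrite inE => /eqP ->. Qed.

(** * Sums of binomial coefficients *)

Lemma sum_iota_ord s m (F G : nat -> nat) :
  (forall i, i < m -> F (s + i) = G i) ->
  \sum_(a <- iota s m) F a = \sum_(i < m) G i.
Proof.
elim: m s G => [|m IH] s G h; first by rewrite big_nil big_ord0.
rewrite /= big_cons big_ord_recl -h // addn0; congr (_ + _).
by apply: (IH _ (fun i => G i.+1)) => i im; rewrite addSnnS h.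
Qed.

(** Partial row sums of Pascal's triangle: the number of subsets of an N-set with fewer than m
    elements. *)
Definition psum N m := \sum_(i < m) 'C(N, i).

Lemma psumS N m : psum N.+1 m.+1 = psum N m.+1 + psum N m.
Proof.
rewrite /psum big_ord_recl [in X in _ = X + _]big_ord_recl !bin0 -addnA; congr (_ + _).
by rewrite -big_split; apply: eq_bigr => i _; rewrite binS.
Qed.

Lemma psum_full n : psum n n.+1 = 2 ^ n.
Proof.
rewrite -[2]/(1 + 1) expnDn; apply: eq_bigr => i _.
by rewrite !exp1n !muln1.
Qed.

(** Each induction step is Pascal's rule [psumS]; the extra [2 ^ n] raises the base case to
    [2 ^ n.+1]. *)
Lemma psum_diag M n :
  \sum_(j < M.+1) psum (j + n) n.+1 + 2 ^ n = psum (M + n.+1) n.+2.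
Proof.
elim: M => [|M IH].
  by rewrite big_ord1 add0n add0n !psum_full expnS; lia.
by rewrite big_ord_recr /= addnAC IH !addSn [RHS]psumS addnS.
Qed.

(** By Pascal's rule the sums satisfy S(n+1) = 2 S(n) + 2^n. *)
Lemma psum_total n : 2 * (\sum_(j < n.+1) psum n j.+1) = (n + 2) * 2 ^ n.
Proof.
elim: n => [|n IH]; first by rewrite big_ord1 psum_full.
rewrite (eq_bigr (fun j : 'I_n.+2 => psum n j.+1 + psum n j)); last first.
  by move=> j _; rewrite psumS.
rewrite big_split /= big_ord_recr /= [in X in _ + X]big_ord_recl /=.
have -> : psum n n.+2 = 2 ^ n.
  by rewrite /psum big_ord_recr /= bin_small // addn0 -psum_full.
have -> : psum n 0 = 0 by rewrite /psum big_ord0.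
rewrite expnS; move: IH; set S := \sum_(j < n.+1) psum n j.+1.
nia.
Qed.

Lemma hockey_stick n r : \sum_(i < r.+1) 'C(n + i, i) = 'C(n.+1 + r, r).
Proof.
elim: r => [|r IH]; first by rewrite big_ord1 !bin0.
by rewrite big_ord_recr /= IH [n.+1 + r.+1]addnS binS -[n + r.+1]addSnnS addnC.
Qed.

(** * The pair 0101, 0112 *)

(* free1 l m: zeros interspersed with 1, 2, ..., l+m, the last zero preceding
   exactly the letters l+1, ..., l+m; tail1 l r: exactly 0 and l+1, ..., l+r
   may follow. *)
Definition free1 l m x := [/\ good P1 x, asc x = l + m,
  subseq (iota 0 (l + m).+1) x, below (l + m) x &
  [/\ forall K, av0112 x K, forall b, 0 < b <= l -> subseq [:: 0; b; 0] x &
      forall b, l < b -> av0101 x b]].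

Definition tail1 l r x := [/\ good P1 x, 0 < l + r <= asc x,
  subseq (iota 0 (l + r).+1) x, subseq [:: 0; l + r; l + r] x &
  [/\ av0112 x (l + r), forall b, 0 < b <= l -> subseq [:: 0; b; 0] x &
      forall b, l < b <= l + r -> av0101 x b]].

(** A letter b in 1, ..., l would complete 0, b, 0 to 0101; a letter above l+r would complete 0,
    l+r, l+r to 0112. *)
Lemma tail1_next l r x a : tail1 l r x ->
  good P1 (rcons x a) <-> a \in 0 :: iota l.+1 r.
Proof.
move=> [gx ak ch w [av h0 h1]]; rewrite inE mem_iota addSn ltnS; split.
  case/(good_P1 _ gx) => _ a1 a2.
  have [//|na] := eqVneq a 0; apply/andP; split.
    rewrite ltnNge; apply/negP => al.
    by have := a1 0; rewrite h0 lt0n na //= => /(_ isT).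
  rewrite leqNgt; apply/negP => al.
  have := a2 0 (l + r); rewrite w; lia.
move=> ha; apply/(good_P1 _ gx); split; first by lia.
  have [->//|na] := eqVneq a 0; apply: h1; lia.
by move=> c' b' cba; apply: av; lia.
Qed.

(** The new 0 puts each of 1, ..., l+r between zeros, so only 0 remains admissible. *)
Lemma tail1_0 l r x : tail1 l r x -> tail1 (l + r) 0 (rcons x 0).
Proof.
move=> tx; have ga : good P1 (rcons x 0).
  by apply/(tail1_next _ tx); rewrite inE.
case: tx => [gx ak ch w [av h0 h1]]; rewrite /tail1 addn0; split=> //.
- by have := asc_rcons_geq x 0; lia.
- exact: subseq_rconsW.
- exact: subseq_rconsW.
split; first by apply: av0112_rcons.
  move=> b bl; rewrite subseq_rcons3 eqxx.
  by rewrite (chain_subseq (s := [:: 0; b]) ch) ?orbT //=; lia.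
by move=> b; lia.
Qed.

Lemma tail1_step l r x i : tail1 l r x -> i < r ->
  tail1 l i.+1 (rcons x (l + i.+1)).
Proof.
move=> tx ir; have ga : good P1 (rcons x (l + i.+1)).
  by apply/(tail1_next _ tx); rewrite inE mem_iota; lia.
case: tx => [gx ak ch w [av h0 h1]]; split=> //.
- by have := asc_rcons_geq x (l + i.+1); lia.
- apply: subseq_rconsW; apply: chain_subseq ch _ _; first exact: iota_ltn_sorted.
  by apply/allP => j; rewrite mem_iota; lia.
- rewrite subseq_rcons3 eqxx.
  by rewrite (chain_subseq (s := [:: 0; l + i.+1]) ch) ?orbT //=; lia.
split.
- by apply: av0112_rcons => [c b cb|b]; [apply: av|]; lia.
- by move=> b /h0; apply: subseq_rconsW.
- by move=> b bl; apply: av0101_rcons; [apply: h1|]; lia.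
Qed.

(** From above only the ascent bound l+m+1 acts; 1, ..., l are excluded as in a tail state. *)
Lemma free1_next l m x a : free1 l m x ->
  good P1 (rcons x a) <-> a \in 0 :: iota l.+1 m.+1.
Proof.
move=> [gx ak ch bx [av h0 h1]]; rewrite inE mem_iota addSnnS; split.
  case/(good_P1 _ gx) => aa a1 a2.
  have [//|na] := eqVneq a 0; apply/andP; split; last by lia.
  rewrite ltnNge; apply/negP => al.
  by have := a1 0; rewrite h0 lt0n na //= => /(_ isT).
move=> ha; apply/(good_P1 _ gx); split; first by lia.
  have [->//|na] := eqVneq a 0; apply: h1; lia.
exact: av.
Qed.

Lemma free1_0 l m x : free1 l m x -> free1 (l + m) 0 (rcons x 0).
Proof.
move=> fx; have ga : good P1 (rcons x 0).
  by apply/(free1_next _ fx); rewrite inE.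
case: fx => [gx ak ch bx [av h0 h1]]; rewrite /free1 addn0; split=> //.
- by rewrite asc_rcons ?(good_neq0 gx) // ltn0 addn0.
- exact: subseq_rconsW.
- exact: below_rcons.
split; first by move=> K; apply: av0112_rcons.
  move=> b bl; rewrite subseq_rcons3 eqxx.
  by rewrite (chain_subseq (s := [:: 0; b]) ch) ?orbT //=; lia.
move=> b bl; apply: av0101_rcons => [|b0]; first by apply: h1; lia.
by apply: (below_notin (a := b) bx); rewrite ?inE ?eqxx ?orbT.
Qed.

Lemma free1_S l m x : free1 l m x -> free1 l m.+1 (rcons x (l + m).+1).
Proof.
move=> fx; have ga : good P1 (rcons x (l + m).+1).
  by apply/(free1_next _ fx); rewrite inE mem_iota; lia.
case: fx => [gx ak ch bx [av h0 h1]]; rewrite /free1 addnS; split=> //.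
- by rewrite asc_rcons ?(good_neq0 gx) // ltnS below_last // ak addn1.
- exact: chain_rconsS.
- by apply: below_rcons => //; apply: belowW bx _.
split.
- move=> K; apply: av0112_rcons => // c cK.
  by apply: (below_notin (a := (l + m).+1) bx); rewrite ?inE ?eqxx ?orbT.
- by move=> b /h0; apply: subseq_rconsW.
- move=> b bl; apply: av0101_rcons => [|b0]; first exact: h1.
  by apply: (below_notin (a := (l + m).+1) bx); rewrite ?inE ?eqxx ?orbT.
Qed.

(** Repeating a letter met since the last zero forbids all larger letters, new maxima included. *)
Lemma free1_tail l m x i : free1 l m x -> i < m ->
  tail1 l i.+1 (rcons x (l + i.+1)).
Proof.
move=> fx im; have ga : good P1 (rcons x (l + i.+1)).
  by apply/(free1_next _ fx); rewrite inE mem_iota; lia.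
case: fx => [gx ak ch bx [av h0 h1]]; split=> //.
- by have := asc_rcons_geq x (l + i.+1); lia.
- apply: subseq_rconsW; apply: chain_subseq ch _ _; first exact: iota_ltn_sorted.
  by apply/allP => j; rewrite mem_iota; lia.
- rewrite subseq_rcons3 eqxx.
  by rewrite (chain_subseq (s := [:: 0; l + i.+1]) ch) ?orbT //=; lia.
split.
- by apply: av0112_rcons => // b; lia.
- by move=> b /h0; apply: subseq_rconsW.
- by move=> b bl; apply: av0101_rcons; [apply: h1|]; lia.
Qed.

(** The letter 0 leaves a single extension, and l+i+1 leads to the state with r = i+1: a
    hockey-stick sum. *)
Lemma size_tail1 n l r x : tail1 l r x -> size (ext P1 n x) = 'C(n + r, r).
Proof.
elim: n l r x => [|n IH] l r x tx; first by rewrite binn.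
have gx : good P1 x by case: tx.
rewrite (size_extS _ gx _ (fun a => tail1_next a tx)); last first.
  by rewrite cons_uniq iota_uniq mem_iota.
rewrite big_cons (IH _ _ _ (tail1_0 tx)).
rewrite (sum_iota_ord (G := fun i => 'C(n + i.+1, i.+1))) => [|i ir].
  by rewrite -hockey_stick big_ord_recl.
by rewrite addSnnS; apply: IH (tail1_step tx ir).
Qed.

(** The count depends on n and m only. Doubling and moving [2 ^ n] to the left avoid halves and
    truncated subtraction. *)
Lemma size_free1 n l m x : free1 l m x ->
  2 * size (ext P1 n x) + 2 * 2 ^ n =
  n * 2 ^ n + 4 + 2 * \sum_(k < n) 'C(n + m, m + k).
Proof.
elim: n l m x => [|n IH] l m x fx; first by rewrite big_ord0.
have gx : good P1 x by case: fx.
rewrite (size_extS _ gx _ (fun a => free1_next a fx)); last first.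
  by rewrite cons_uniq iota_uniq mem_iota.
rewrite big_cons -(addn1 m) iotaD big_cat /= big_seq1 addSn.
have := IH _ _ _ (free1_0 fx); have := IH _ _ _ (free1_S fx).
rewrite (sum_iota_ord (G := fun i => 'C(n + i.+1, i.+1))) => [|i im]; last first.
  by rewrite addSnnS; apply: size_tail1 (free1_tail fx im).
(* The tail states add ['C(n.+1 + m, m) - 1]. This binomial is the k = 0 term of the target sum; the
   other terms form the sum for the state [free1 l m.+1]. *)
have := hockey_stick n m; rewrite big_ord_recl addn0 bin0.
rewrite [\sum_(k < n.+1) _]big_ord_recl /= addn0.
have -> : \sum_(i < n) 'C(n.+1 + m, m + bump 0 i) =
          \sum_(k < n) 'C(n + m.+1, m.+1 + k).
  by apply: eq_bigr => i _; rewrite /bump /= add1n !addSnnS.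
have -> : \sum_(i < m) 'C(n + bump 0 i, bump 0 i) =
          \sum_(i < m) 'C(n + i.+1, i.+1) by [].
have -> : \sum_(k < n) 'C(n, 0 + k) = \sum_(k < n) 'C(n, k) by [].
have := psum_full n; rewrite /psum big_ord_recr /= binn expnS; nia.
Qed.

Lemma free1_init : free1 0 0 [:: 0].
Proof.
split=> //; [exact: good_seq1|exact: below_seq1|split].
- by move=> K c b h; apply/negP => /size_subseq.
- by move=> b; lia.
- by move=> b _ c h; apply/negP => /size_subseq.
Qed.

(** * The pair 0102, 0112 *)

(* free2 k: 0...012...k; tail2 k: exactly the letters 0, ..., k may follow. *)
Definition free2 k x := [/\ good P2 x, asc x = k, subseq (iota 0 k.+1) x,
  below k x & forall K, av0102 x K /\ av0112 x K].

Definition tail2 k x := [/\ good P2 x, k <= asc x, subseq (iota 0 k.+1) x,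
  av0102 x k /\ av0112 x k &
  exists c b, c < b <= k /\ (subseq [:: c; b; c] x || subseq [:: c; b; b] x)].

(** A letter above k would complete the witness to 0102 or 0112; for smaller letters avoidance
    follows from avoidance at k. *)
Lemma tail2_next k x a : tail2 k x ->
  good P2 (rcons x a) <-> a \in iota 0 k.+1.
Proof.
move=> [gx ak ch [av1 av2] [c [b [cb w]]]]; rewrite mem_iota add0n ltnS /=; split.
  case/(good_P2 _ gx) => _ h1 h2; rewrite leqNgt; apply/negP => ka.
  have cba : c < b < a by lia.
  by move: w; rewrite (negbTE (h1 _ _ cba)) (negbTE (h2 _ _ cba)).
move=> ha; apply/(good_P2 _ gx); split; first by lia.
  by move=> c' b' cba; apply: av1; lia.
by move=> c' b' cba; apply: av2; lia.
Qed.

(** Now 0, 1, 0 blocks everything above 1, so the letter 0 acts like the letter 1. *)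
Lemma tail2_0 k x : 0 < k -> tail2 k x -> tail2 1 (rcons x 0).
Proof.
move=> k0 tx; have ga : good P2 (rcons x 0) by apply/(tail2_next _ tx).
case: tx => [gx ak ch [av1 av2] _]; split=> //.
- by apply: leq_trans (asc_rcons_geq _ _); lia.
- apply: subseq_rconsW; apply: chain_subseq ch _ _ => //=; lia.
- by split=> c b; lia.
- exists 0, 1; split=> //; rewrite subseq_rcons3 eqxx.
  by rewrite (chain_subseq (s := [:: 0; 1]) ch) ?orbT //=; lia.
Qed.

Lemma tail2_step k x a : tail2 k x -> 0 < a <= k -> tail2 a (rcons x a).
Proof.
move=> tx ax; have ga : good P2 (rcons x a).
  by apply/(tail2_next _ tx); rewrite mem_iota; lia.
case: tx => [gx ak ch [av1 av2] _]; split=> //.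
- by apply: leq_trans (asc_rcons_geq _ _); lia.
- apply: subseq_rconsW; apply: chain_subseq ch _ _; first exact: iota_ltn_sorted.
  by apply/allP => i; rewrite mem_iota; lia.
- split.
    apply: av0102_rcons => [c b cb|b]; [apply: av1|]; lia.
  apply: av0112_rcons => [c b cb|b]; [apply: av2|]; lia.
- exists 0, a; split; first by lia.
  rewrite (subseq_rcons3 _ _ 0 a a) eqxx.
  by rewrite (chain_subseq (s := [:: 0; a]) ch) ?orbT //=; lia.
Qed.

Lemma free2_next k x a : free2 k x ->
  good P2 (rcons x a) <-> a \in iota 0 k.+2.
Proof.
move=> [gx ak ch bx av]; rewrite mem_iota add0n ltnS /=; split.
  by case/(good_P2 _ gx); rewrite ak.
by move=> ha; have [av1 av2] := av a; apply/(good_P2 _ gx); split=> //; rewrite ak.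
Qed.

(** With no letter above 0 present, a repeated 0 encloses nothing. *)
Lemma free2_0 x : free2 0 x -> free2 0 (rcons x 0).
Proof.
move=> fx; have ga : good P2 (rcons x 0) by apply/(free2_next _ fx).
case: fx => [gx ak ch bx av]; split=> //.
- by rewrite asc_rcons ?(good_neq0 gx) // ltn0 addn0.
- exact: subseq_rconsW.
- exact: below_rcons.
- move=> K; have [av1 av2] := av K; split; last exact: av0112_rcons.
  apply: av0102_rcons => // b b0.
  by apply: (below_notin (a := b) bx); rewrite ?inE ?eqxx ?orbT //; lia.
Qed.

Lemma free2_S k x : free2 k x -> free2 k.+1 (rcons x k.+1).
Proof.
move=> fx; have ga : good P2 (rcons x k.+1).
  by apply/(free2_next _ fx); rewrite mem_iota; lia.
case: fx => [gx ak ch bx av]; split=> //.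
- by rewrite asc_rcons ?(good_neq0 gx) // ltnS below_last // ak addn1.
- exact: chain_rconsS.
- by apply: below_rcons => //; apply: belowW bx _.
- move=> K; have [av1 av2] := av K; split.
    apply: av0102_rcons => // c cK.
    by apply: (below_notin (a := k.+1) bx); rewrite ?inE ?eqxx ?orbT.
  apply: av0112_rcons => // c cK.
  by apply: (below_notin (a := k.+1) bx); rewrite ?inE ?eqxx ?orbT.
Qed.

Lemma free2_tail0 k x : free2 k.+1 x -> tail2 1 (rcons x 0).
Proof.
move=> fx; have ga : good P2 (rcons x 0) by apply/(free2_next _ fx).
case: fx => [gx ak ch bx av]; split=> //.
- by apply: leq_trans (asc_rcons_geq _ _); lia.
- exact/subseq_rconsW/(chain_subseq ch).
- by split=> c b; lia.
- exists 0, 1; split=> //; rewrite subseq_rcons3 eqxx.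
  by rewrite (chain_subseq (s := [:: 0; 1]) ch) ?orbT.
Qed.

Lemma free2_tail k x a : free2 k x -> 0 < a <= k -> tail2 a (rcons x a).
Proof.
move=> fx ax; have ga : good P2 (rcons x a).
  by apply/(free2_next _ fx); rewrite mem_iota; lia.
case: fx => [gx ak ch bx av]; have [av1 av2] := av a; split=> //.
- by apply: leq_trans (asc_rcons_geq _ _); lia.
- apply: subseq_rconsW; apply: chain_subseq ch _ _; first exact: iota_ltn_sorted.
  by apply/allP => i; rewrite mem_iota; lia.
- by split; [apply: av0102_rcons|apply: av0112_rcons] => // b; lia.
- exists 0, a; split; first by lia.
  rewrite (subseq_rcons3 _ _ 0 a a) eqxx.
  by rewrite (chain_subseq (s := [:: 0; a]) ch) ?orbT //=; lia.
Qed.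

(** The letter 0 contributes [2 ^ n] and the letters 1, ..., k+1 a diagonal of partial sums, added
    up by [psum_diag]. *)
Lemma size_tail2 n k x : tail2 k.+1 x -> size (ext P2 n x) = psum (k + n) n.+1.
Proof.
elim: n k x => [|n IH] k x tx; first by rewrite /psum big_ord1 bin0.
have gx : good P2 x by case: tx.
rewrite (size_extS _ gx _ (fun a => tail2_next a tx)) ?iota_uniq //.
rewrite -[iota 0 _]/(0 :: iota 1 k.+1) big_cons (IH 0 _ (tail2_0 _ tx)) // psum_full.
rewrite (sum_iota_ord (G := fun i => psum (i + n) n.+1)) => [|i ik].
  by rewrite addnC psum_diag.
by rewrite add1n; apply: IH; apply: tail2_step tx _.
Qed.

(** The letters 0, ..., k+1 together give the last term of the new sum, the new maximum gives all
    others. *)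
Lemma size_free2S n k x : free2 k.+1 x ->
  size (ext P2 n x) = \sum_(j < n.+1) psum (k + n) j.+1.
Proof.
elim: n k x => [|n IH] k x fx; first by rewrite big_ord1 /psum big_ord1 bin0.
have gx : good P2 x by case: fx.
rewrite (size_extS _ gx _ (fun a => free2_next a fx)) ?iota_uniq //.
rewrite -[iota 0 _]/(0 :: iota 1 k.+2) big_cons.
rewrite (size_tail2 (k := 0) n (free2_tail0 fx)) psum_full.
rewrite -(addn1 k.+1) iotaD big_cat [iota _ 1]/= big_seq1 add1n (IH _ _ (free2_S fx)).
rewrite (sum_iota_ord (G := fun i => psum (i + n) n.+1)) => [|i ik].
  by rewrite addnA [2 ^ n + _]addnC psum_diag [RHS]big_ord_recr /= addnC addSnnS.
by rewrite add1n; apply: size_tail2; apply: free2_tail fx _.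
Qed.

Lemma size_free2 n x : free2 0 x -> 2 * size (ext P2 n x) = n * 2 ^ n + 2.
Proof.
elim: n x => // n IH x fx.
have gx : good P2 x by case: fx.
rewrite (size_extS _ gx _ (fun a => free2_next a fx)) ?iota_uniq //.
rewrite !big_cons big_nil.
have := IH _ (free2_0 fx); rewrite (size_free2S n (free2_S fx)) add0n.
have := psum_total n; rewrite expnS; nia.
Qed.

Lemma free2_init : free2 0 [:: 0].
Proof.
split=> //; [exact: good_seq1|exact: below_seq1|].
by move=> K; split=> c b h; apply/negP => /size_subseq.
Qed.

(** * The pair 0121, 0112 *)

(* free3 k: zeros interspersed with 1, 2, ..., k; tail3 k: k has been repeated
   and only 0 and k may follow. *)
Definition free3 k x := [/\ good P3 x, asc x = k, subseq (iota 0 k.+1) x,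
  below k x & forall K, av0112 x K].

Definition tail3 k x := [/\ good P3 x, k <= asc x, subseq (iota 0 k.+1) x,
  below k x & av0112 x k /\ subseq [:: 0; k; k] x].

(** A letter a strictly between 0 and k would complete 0, a, k to 0121; one above k would complete
    0, k, k to 0112. *)
Lemma tail3_next k x a : 0 < k -> tail3 k x ->
  good P3 (rcons x a) <-> a \in [:: 0; k].
Proof.
move=> k0 [gx ak ch bx [av s]]; rewrite !inE; split.
  case/(good_P3 _ gx) => _ h1 h2.
  have [//|a0] := eqVneq a 0; have [//|nk] := eqVneq a k.
  have [ka|ka] := ltnP k a.
    by have := h2 0 k; rewrite s k0 ka => /(_ isT).
  have := h1 0 k; rewrite (chain_subseq ch) /=; lia.
move=> ha; apply/(good_P3 _ gx); split; first by lia.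
  by move=> c b cab; apply: (below_notin (a := b) bx); rewrite ?inE ?eqxx ?orbT //; lia.
by move=> c b cba; apply: av; lia.
Qed.

Lemma tail3_step k x a : 0 < k -> tail3 k x -> a \in [:: 0; k] ->
  tail3 k (rcons x a).
Proof.
move=> k0 tx ax; have ga : good P3 (rcons x a) by apply/(tail3_next _ k0 tx).
case: tx => [gx ak ch bx [av s]]; split=> //.
- exact: leq_trans (asc_rcons_geq _ _).
- exact: subseq_rconsW.
- by apply: below_rcons => //; move: ax; rewrite !inE; lia.
- split; last exact: subseq_rconsW.
  by apply: av0112_rcons => // c; move: ax; rewrite !inE; lia.
Qed.

(** [undup] merges 0 and k when k = 0. *)
Lemma free3_next k x a : free3 k x ->
  good P3 (rcons x a) <-> a \in undup [:: 0; k; k.+1].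
Proof.
move=> [gx ak ch bx av]; rewrite mem_undup !inE; split.
  case/(good_P3 _ gx) => a1 h1 h2.
  have [//|a0] := eqVneq a 0; have [//|nk] := eqVneq a k.
  have [//|nk1] := eqVneq a k.+1.
  have := h1 0 k; rewrite (chain_subseq ch) /=; lia.
move=> ha; apply/(good_P3 _ gx); split; first by lia.
  by move=> c b cab; apply: (below_notin (a := b) bx); rewrite ?inE ?eqxx ?orbT //; lia.
exact: av.
Qed.

Lemma free3_0 k x : free3 k x -> free3 k (rcons x 0).
Proof.
move=> fx; have ga : good P3 (rcons x 0).
  by apply/(free3_next _ fx); rewrite mem_undup inE.
case: fx => [gx ak ch bx av]; split=> //.
- by rewrite asc_rcons ?(good_neq0 gx) // ltn0 addn0.
- exact: subseq_rconsW.
- exact: below_rcons.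
- by move=> K; apply: av0112_rcons.
Qed.

Lemma free3_S k x : free3 k x -> free3 k.+1 (rcons x k.+1).
Proof.
move=> fx; have ga : good P3 (rcons x k.+1).
  by apply/(free3_next _ fx); rewrite mem_undup !inE eqxx !orbT.
case: fx => [gx ak ch bx av]; split=> //.
- by rewrite asc_rcons ?(good_neq0 gx) // ltnS below_last // ak addn1.
- exact: chain_rconsS.
- by apply: below_rcons => //; apply: belowW bx _.
- move=> K; apply: av0112_rcons => // c cK.
  by apply: (below_notin (a := k.+1) bx); rewrite ?inE ?eqxx ?orbT.
Qed.

Lemma free3_tail k x : 0 < k -> free3 k x -> tail3 k (rcons x k).
Proof.
move=> k0 fx; have ga : good P3 (rcons x k).
  by apply/(free3_next _ fx); rewrite mem_undup !inE eqxx !orbT.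
case: fx => [gx ak ch bx av]; split=> //.
- by rewrite -{1}ak asc_rcons_geq.
- exact: subseq_rconsW.
- exact: below_rcons.
- split; first by apply: av0112_rcons => // c; lia.
  by rewrite subseq_rcons3 eqxx (chain_subseq (s := [:: 0; k]) ch) ?orbT //=; lia.
Qed.

Lemma size_tail3 n k x : 0 < k -> tail3 k x -> size (ext P3 n x) = 2 ^ n.
Proof.
move=> k0; elim: n x => // n IH x tx.
have gx : good P3 x by case: tx.
rewrite (size_extS _ gx _ (fun a => tail3_next a k0 tx)); last by rewrite /= inE; lia.
rewrite !big_cons big_nil !IH ?expnS; try by apply: tail3_step; rewrite // !inE eqxx ?orbT.
lia.
Qed.

(** Two letters, 0 and the new maximum, keep the state free, and repeating the maximum adds [2 ^ n];
    the count is the same for all k. *)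
Lemma size_free3S n k x : free3 k.+1 x ->
  2 * size (ext P3 n x) = (n + 2) * 2 ^ n.
Proof.
elim: n k x => // n IH k x fx.
have gx : good P3 x by case: fx.
rewrite (size_extS _ gx _ (fun a => free3_next a fx)) ?undup_uniq //.
rewrite undup_id; last by rewrite /= !inE; lia.
rewrite !big_cons big_nil (size_tail3 _ _ (free3_tail _ fx)) //.
have := IH _ _ (free3_0 fx); have := IH _ _ (free3_S fx).
rewrite expnS; nia.
Qed.

Lemma size_free3 n x : free3 0 x -> 2 * size (ext P3 n x) = n * 2 ^ n + 2.
Proof.
elim: n x => // n IH x fx.
have gx : good P3 x by case: fx.
rewrite (size_extS _ gx _ (fun a => free3_next a fx)) ?undup_uniq //.
rewrite !big_cons big_nil.
have := IH _ (free3_0 fx); have := size_free3S n (free3_S fx).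
rewrite expnS; nia.
Qed.

Lemma free3_init : free3 0 [:: 0].
Proof.
split=> //; [exact: good_seq1|exact: below_seq1|].
by move=> K c b h; apply/negP => /size_subseq.
Qed.

(** * The pair 0102, 0120 *)

(* free4 k: weakly increasing prefixes ending in k; tail4 k: k follows k+1 and
   only k and k+1 may follow. *)
Definition tail4 k x := [/\ good P4 x, k < asc x, subseq (iota 0 k.+2) x,
  below k.+1 x & av0102 x k.+1 /\ subseq [:: k; k.+1; k] x].

Definition free4 k x := [/\ good P4 x, asc x = k, subseq (iota 0 k.+1) x,
  below k x & last 0 x = k /\ forall K, av0102 x K].

(** A letter a < k would complete a, a+1, a+2 to 0120; one above k+1 would complete k, k+1, k to
    0102. *)
Lemma tail4_next k x a : tail4 k x ->
  good P4 (rcons x a) <-> a \in [:: k; k.+1].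
Proof.
move=> [gx ak ch bx [av s]]; rewrite !inE; split.
  case/(good_P4 _ gx) => _ h1 h2.
  have [ka|ka] := ltnP k.+1 a.
    by have := h1 k k.+1; rewrite s ka ltnSn => /(_ isT).
  have [ka'|ka'] := ltnP a k; last lia.
  have := h2 a.+1 a.+2; rewrite (chain_subseq ch) /=; lia.
move=> ha; apply/(good_P4 _ gx); split; first by lia.
  by move=> c b cba; apply: av; lia.
by move=> b c cab; apply: (below_notin (a := c) bx); rewrite ?inE ?eqxx ?orbT //; lia.
Qed.

Lemma tail4_step k x a : tail4 k x -> a \in [:: k; k.+1] -> tail4 k (rcons x a).
Proof.
move=> tx ax; have ga : good P4 (rcons x a) by apply/(tail4_next _ tx).
case: tx => [gx ak ch bx [av s]]; split=> //.
- exact: leq_trans (asc_rcons_geq _ _).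
- exact: subseq_rconsW.
- by apply: below_rcons => //; move: ax; rewrite !inE; lia.
- split; last exact: subseq_rconsW.
  by apply: av0102_rcons => // c; move: ax; rewrite !inE; lia.
Qed.

(** The letter k-1 survives because only one larger value is present; [undup] merges it with k when
    k = 0. *)
Lemma free4_next k x a : free4 k x ->
  good P4 (rcons x a) <-> a \in undup [:: k.-1; k; k.+1].
Proof.
move=> [gx ak ch bx [lx av]]; rewrite mem_undup !inE; split.
  case/(good_P4 _ gx) => a1 h1 h2.
  have [ka'|ka'] := ltnP a k.-1; last lia.
  have := h2 a.+1 a.+2; rewrite (chain_subseq ch) /=; lia.
move=> ha; apply/(good_P4 _ gx); split; [by lia|exact: av|].
by move=> b c cab; apply: (below_notin (a := c) bx); rewrite ?inE ?eqxx ?orbT //; lia.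
Qed.

Lemma free4_id k x : free4 k x -> free4 k (rcons x k).
Proof.
move=> fx; have ga : good P4 (rcons x k).
  by apply/(free4_next _ fx); rewrite mem_undup !inE eqxx ?orbT.
case: fx => [gx ak ch bx [lx av]]; split=> //.
- by rewrite asc_rcons ?(good_neq0 gx) // lx ltnn addn0.
- exact: subseq_rconsW.
- exact: below_rcons.
- split=> [|K]; first by rewrite last_rcons.
  apply: av0102_rcons => // b kb.
  by apply: (below_notin (a := b) bx); rewrite ?inE ?eqxx ?orbT //; lia.
Qed.

Lemma free4_S k x : free4 k x -> free4 k.+1 (rcons x k.+1).
Proof.
move=> fx; have ga : good P4 (rcons x k.+1).
  by apply/(free4_next _ fx); rewrite mem_undup !inE eqxx !orbT.
case: fx => [gx ak ch bx [lx av]]; split=> //.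
- by rewrite asc_rcons ?(good_neq0 gx) // lx ltnSn ak addn1.
- exact: chain_rconsS.
- by apply: below_rcons => //; apply: belowW bx _.
- split=> [|K]; first by rewrite last_rcons.
  apply: av0102_rcons => // b kb.
  by apply: (below_notin (a := b) bx); rewrite ?inE ?eqxx ?orbT //; lia.
Qed.

Lemma free4_tail k x : free4 k.+1 x -> tail4 k (rcons x k).
Proof.
move=> fx; have ga : good P4 (rcons x k).
  by apply/(free4_next _ fx); rewrite mem_undup !inE eqxx ?orbT.
case: fx => [gx ak ch bx [lx av]]; split=> //.
- by rewrite -ak asc_rcons_geq.
- exact: subseq_rconsW.
- exact: below_rcons.
- split; first by apply: av0102_rcons => // c; lia.
  by rewrite subseq_rcons3 eqxx (chain_subseq (s := [:: k; k.+1]) ch) ?orbT //=; lia.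
Qed.

Lemma size_tail4 n k x : tail4 k x -> size (ext P4 n x) = 2 ^ n.
Proof.
elim: n x => // n IH x tx.
have gx : good P4 x by case: tx.
rewrite (size_extS _ gx _ (fun a => tail4_next a tx)); last by rewrite /= inE; lia.
rewrite !big_cons big_nil !IH ?expnS; try by apply: tail4_step; rewrite // !inE eqxx ?orbT.
lia.
Qed.

(** The current and the new maximum keep the state free, while the descent to k adds [2 ^ n]. *)
Lemma size_free4S n k x : free4 k.+1 x ->
  2 * size (ext P4 n x) = (n + 2) * 2 ^ n.
Proof.
elim: n k x => // n IH k x fx.
have gx : good P4 x by case: fx.
rewrite (size_extS _ gx _ (fun a => free4_next a fx)) ?undup_uniq //.
rewrite undup_id; last by rewrite /= !inE; lia.
rewrite !big_cons big_nil (size_tail4 _ (free4_tail fx)).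
have := IH _ _ (free4_id fx); have := IH _ _ (free4_S fx).
rewrite expnS; nia.
Qed.

Lemma size_free4 n x : free4 0 x -> 2 * size (ext P4 n x) = n * 2 ^ n + 2.
Proof.
elim: n x => // n IH x fx.
have gx : good P4 x by case: fx.
rewrite (size_extS _ gx _ (fun a => free4_next a fx)) ?undup_uniq //.
rewrite !big_cons big_nil.
have := IH _ (free4_id fx); have := size_free4S n (free4_S fx).
rewrite expnS; nia.
Qed.

Lemma free4_init : free4 0 [:: 0].
Proof.
split=> //; [exact: good_seq1|exact: below_seq1|split=> //].
by move=> K c b h; apply/negP => /size_subseq.
Qed.

(** * Closed form for the four pairs *)

Theorem theorem3p2 (n : nat) : 1 <= n ->
  let v := (n - 1) * 2 ^ (n - 2) + 1 in
  [/\ aP [:: [:: 0; 1; 0; 1]; [:: 0; 1; 1; 2]] n = v,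
      aP [:: [:: 0; 1; 0; 2]; [:: 0; 1; 1; 2]] n = v,
      aP [:: [:: 0; 1; 2; 1]; [:: 0; 1; 1; 2]] n = v &
      aP [:: [:: 0; 1; 0; 2]; [:: 0; 1; 2; 0]] n = v].
Proof.
case: n => // n _ v.
have v2 N : 2 * N = n * 2 ^ n + 2 -> N = v.
  (* For length one the exponent truncates to 0, harmlessly, since its factor is 0. *)
  rewrite /v subn1 /=; case: n {v} => [|n]; first by rewrite mul0n; lia.
  rewrite subSS subn1 /= expnS; nia.
split; rewrite aP_ext ?good_seq1 //; apply: v2.
(* At m = 0 the binomial sum is a full row without its last entry, 2^n - 1. *)
- have := size_free1 n free1_init; have := psum_full n.
  rewrite /psum big_ord_recr /= binn.
  rewrite (eq_bigr (fun k : 'I_n => 'C(n + 0, 0 + k))) => [|i _]; last by rewrite addn0.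
  move: (size _) (\sum_(i < n) _) => X S; lia.
- exact: size_free2 free2_init.
- exact: size_free3 free3_init.
- exact: size_free4 free4_init.
Qed.
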